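(* Let $\pi=\prod_{i\in\mathcal{N}_t}\pi^i$ be a factorized categorical policy and, for a state $s_t$, define $\mathbf{x}_t(s_t)\in\mathbb{R}^{\Omega_t}$ by $x_{(i,a)}(s_t)=\pi^i(a\mid\mathcal{O}(s_t,i))$ for $(i,a)\in\Omega_t$. Then, for any fixed state $s_t$, the conditional expected stage utility under $\pi$ equals the PME at these marginals: $$\mathbb{E}_{A_t\sim\pi}\big[F_t(A_t;s_t)\,\big|\,s_t\big]=\tilde f_t(\mathbf{x}_t(s_t);s_t).$$ Consequently $J_t(\pi)=\mathbb{E}_{s_t\sim\mu_t^\pi}\big[\tilde f_t(\mathbf{x}_t(s_t);s_t)\big]$, where $J_t(\pi)=\mathbb{E}_\pi[F_t(A_t;s_t)]$ and $\mu_t^\pi$ is the marginal state distribution at round $t$ induced by $\pi$.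
   Context: $\mathcal{N}_t$ is a finite set of agents; each agent $i$ has a finite nonempty action set $\mathcal{A}_{i,t}$. $\Omega_t=\{(i,a):i\in\mathcal{N}_t,a\in\mathcal{A}_{i,t}\}$, $\Omega_{i,t}=\{(i,a):a\in\mathcal{A}_{i,t}\}$, $\mathcal{I}_t=\{A\subseteq\Omega_t:|A\cap\Omega_{i,t}|\le1\ \forall i\}$. At state $s_t$ agent $i$ observes $o_{i,t}=\mathcal{O}(s_t,i)$. A factorized categorical policy is $\pi(\mathbf{a}_t\mid\mathbf{o}_t)=\prod_{i\in\mathcal{N}_t}\pi^i(a_{i,t}\mid o_{i,t})$, each $\pi^i(\cdot\mid o)$ a probability distribution on $\mathcal{A}_{i,t}$; i.e. given $s_t$ agents sample independently, and $A_t=\{(i,a_{i,t}):i\in\mathcal{N}_t\}$. $F_t(\cdot;s_t):2^{\Omega_t}\to\mathbb{R}_{\ge0}$ is normalized, monotone and submodular (standing assumption). Partition Multilinear Extension (PME): for $\mathbf{x}\in[0,1]^{\Omega_t}$ with $\sum_a x_{(i,a)}\le1$ for all $i$, $\tilde f_t(\mathbf{x};s_t)=\sum_{A\in\mathcal{I}_t}F_t(A;s_t)\prod_{i\in\mathcal{N}_t}p_i(A;\mathbf{x})$, where $p_i(A;\mathbf{x})=x_{(i,a)}$ if $A\cap\Omega_{i,t}=\{(i,a)\}$ and $p_i(A;\mathbf{x})=1-\sum_{a'\in\mathcal{A}_{i,t}}x_{(i,a')}$ if $A\cap\Omega_{i,t}=\emptyset$. *)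

(* Defs.v *)
From HB Require Import structures.
From mathcomp Require Import all_boot all_order all_algebra.
From mathcomp Require Import all_classical all_reals all_analysis.

Set Implicit Arguments.
Unset Strict Implicit.
Unset Printing Implicit Defensive.

Import Order.TTheory GRing.Theory Num.Theory.
Local Open Scope ring_scope.

Definition normalized_fun (R : realType) (T : finType) (f : {set T} -> R) :=
  f (finset.set0) = 0.

Definition monotone_fun (R : realType) (T : finType) (f : {set T} -> R) :=
  forall X Y : {set T}, X \subset Y -> f X <= f Y.

Definition submodular_fun (R : realType) (T : finType) (f : {set T} -> R) :=
  forall X Y : {set T}, f (X :|: Y) + f (X :&: Y) <= f X + f Y.

Section Ground.
Variables (N : finType) (A : N -> finType).

Definition ground := {i : N & A i}.

Definition elt (i : N) (a : A i) : ground := Tagged (fun j => A j) a.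

Definition block (i : N) : {set ground} := [set u : ground | tag u == i].

Definition indep_sets : {set {set ground}} :=
  [set X : {set ground} | [forall i, #|X :&: block i| <= 1]%N].

Definition profile := {dffun forall i : N, A i}.

Definition action_set (b : profile) : {set ground} := [set elt (b i) | i : N].

End Ground.

Section PME.
Variables (R : realType) (N : finType) (A : N -> finType).
Implicit Types (x : ground A -> R) (X : {set ground A}) (f : {set ground A} -> R).

Definition pme_domain x :=
  (forall u, 0 <= x u <= 1) /\ (forall i, \sum_(a : A i) x (elt a) <= 1).

(* For [X] in [indep_sets A], the intersection with a block is either a
   singleton or empty, so the default branch is exactly the empty case. *)
Definition pme_factor x X (i : N) : R :=
  if [pick a : A i | X :&: block A i == [set elt a]] is Some a
  then x (elt a) else 1 - \sum_(a : A i) x (elt a).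

Definition pme f x : R :=
  \sum_(X in indep_sets A) f X * \prod_(i : N) pme_factor x X i.

End PME.

Section Policy.
Variables (R : realType) (N : finType) (A : N -> finType).
Variables (dO : measure_display) (Obs : N -> measurableType dO).
Implicit Types (pi : forall i, Obs i -> A i -> R) (o : forall i, Obs i).

Definition is_policy pi :=
  [/\ forall i (z : Obs i) a, 0 <= pi i z a,
      forall i (z : Obs i), \sum_(a : A i) pi i z a = 1 &
      forall i a, measurable_fun [set: Obs i]%classic (fun z => pi i z a)].

Definition joint_policy pi o (b : profile A) : R := \prod_(i : N) pi i (o i) (b i).

(* Expected value of [f (A_t)] when the joint action is drawn from the
   (finitely supported) law [joint_policy pi o]. *)
Definition policy_expectation pi o (f : {set ground A} -> R) : R :=
  \sum_(b : profile A) joint_policy pi o b * f (action_set b).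

Definition marginals pi o : ground A -> R := fun u => pi (tag u) (o (tag u)) (tagged u).

End Policy.

Section Sampling.
Variables (R : realType) (N : finType) (A : N -> finType).
Variables (dO dS dT : measure_display).
Variables (Obs : N -> measurableType dO) (S : measurableType dS).
Variables (T : measurableType dT) (P : probability T R).

(* [joint_policy pi (O s)] is a regular conditional law, given [st = s], of the
   random joint action [act]; [distribution P st] is the law of the state. *)
Definition plays_policy (pi : forall i, Obs i -> A i -> R)
    (O : S -> forall i, Obs i) (st : {mfun T >-> S}) (act : T -> profile A) :=
  (forall b, measurable (act @^-1` [set b])%classic) /\
  (forall (b : profile A) (B : set S), measurable B ->
     P (st @^-1` B `&` act @^-1` [set b])%classic =
     (\int[distribution P st]_(s in B) (joint_policy pi (O s) b)%:E)%E).

Definition stage_value (F : S -> {set ground A} -> R)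
    (st : {mfun T >-> S}) (act : T -> profile A) : \bar R :=
  ('E_P[fun w => F (st w) (action_set (act w))])%E.

End Sampling.

(* Main.v *)
Require Import Defs.
From mathcomp Require Import all_boot all_order all_algebra.
From mathcomp Require Import all_classical all_reals all_analysis measurable_realfun.

(** Given the state, the action sets are exactly the independent sets meeting
    every block, and [action_set] is injective on profiles. Each policy puts
    total mass one on a block, so in the PME the sets missing a block have
    weight zero and the remaining terms are those of the expectation.
    For the unconditional identity, the event [act = b] is disintegrated along
    the state with density [joint_policy pi (O s) b], first for simple functions
    and then by monotone convergence; summing over the finitely many profiles
    [b] turns the stage value into the integral of the PME. *)

Import Order.TTheory GRing.Theory Num.Theory.
Local Open Scope ring_scope.

(** * Action sets of profiles, and the PME at points of block mass one *)

Section ActionSets.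
Context {N : finType} {A : N -> finType}.
Implicit Types (b : profile A) (X : {set ground A}).

Lemma elt_inj i : injective (@elt N A i).
Proof. by move=> a a' /eqP; rewrite eq_Tagged => /eqP. Qed.

Lemma mem_action_set b (u : ground A) : (u \in action_set b) = (tagged u == b (tag u)).
Proof.
case: u => i a /=; apply/imsetP/eqP => [[j _ E]|->]; last by exists i.
have ji := congr1 tag E; rewrite /= in ji; subst j.
exact: elt_inj E.
Qed.

Lemma action_setI_block b i : action_set b :&: block A i = [set elt (b i)].
Proof.
apply/setP => u; rewrite !inE mem_action_set.
case: u => j a /=; apply/andP/eqP => [[/eqP -> /eqP ->]//|E].
have ji := congr1 tag E; rewrite /= in ji; subst j.
by split=> //; apply/eqP; exact: elt_inj E.
Qed.

Lemma action_set_indep b : action_set b \in indep_sets A.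
Proof. by rewrite inE; apply/forallP => i; rewrite action_setI_block cards1. Qed.

Lemma action_set_inj : injective (@action_set N A).
Proof.
move=> b b' E; apply/ffunP => i; apply: (@elt_inj i); apply: set1_inj.
by rewrite -!action_setI_block E.
Qed.

(** The blocks cover the ground set, so a set is determined by its traces on them. This is the
    surjectivity half of the correspondence between profiles and sets meeting every block in one
    element. *)
Lemma action_set_of_blocks X (b : forall i, A i) :
  (forall i, X :&: block A i = [set elt (b i)]) -> X = action_set [ffun i => b i].
Proof.
move=> Xb; apply/setP => u.
have /setP/(_ u) := Xb (tag u); rewrite !inE eqxx andbT => ->.
by rewrite mem_action_set ffunE; case: u => i a /=; rewrite (inj_eq (@elt_inj i)).
Qed.

Context {R : realType}.
Implicit Type x : ground A -> R.

Lemma pme_factor_action_set x b i : pme_factor x (action_set b) i = x (elt (b i)).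
Proof.
rewrite /pme_factor action_setI_block.
case: pickP => [a /eqP/set1_inj/elt_inj <- //|/(_ (b i))].
by rewrite eqxx.
Qed.

(** At block mass one the default branch of [pme_factor] is 1 - 1 = 0, so a nonzero factor must come
    from the singleton branch. *)
Lemma pme_factor_neq0 x X i : \sum_(a : A i) x (elt a) = 1 ->
  pme_factor x X i != 0 -> exists a : A i, X :&: block A i = [set elt a].
Proof.
move=> x1; rewrite /pme_factor; case: pickP => [a /eqP Xa _|_]; first by exists a.
by rewrite x1 subrr eqxx.
Qed.

Lemma pme_profile_sum (f : {set ground A} -> R) x :
  (forall i, \sum_(a : A i) x (elt a) = 1) ->
  pme f x = \sum_(b : profile A) (\prod_i x (elt (b i))) * f (action_set b).
Proof.
(* The intermediate sum runs over the image of [action_set]; injectivity reindexes it by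
   profiles. *)
move=> x1; transitivity (\sum_(X in [set action_set b | b : profile A])
    f X * \prod_i pme_factor x X i); last first.
  rewrite big_imset /=; last by move=> b b' _ _; exact: action_set_inj.
  apply: eq_bigr => b _; rewrite mulrC; congr (_ * _).
  by apply: eq_bigr => i _; rewrite pme_factor_action_set.
rewrite /pme [LHS]big_mkcond [RHS]big_mkcond; apply: eq_bigr => X _.
case: ifPn => [_|Xn]; last first.
  by case: ifPn => // /imsetP[b _ Xb]; rewrite Xb action_set_indep in Xn.
(* For an independent set outside the image the term must vanish. Contrapositively, if no factor is
   zero, each block supplies an action, and [fin_all_exists] gathers these into a profile whose
   action set is [X]. *)
case: ifPn => // Xim; apply/eqP; apply: contraNT Xim.
rewrite mulf_eq0 negb_or => /andP[_ /prodf_neq0 X0].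
have /fin_all_exists[b Xb] : forall i, exists a : A i, X :&: block A i = [set elt a].
  by move=> i; apply: pme_factor_neq0 (X0 i isT).
by apply/imsetP; exists [ffun i => b i] => //; exact: action_set_of_blocks.
Qed.

Lemma mass1_pme_domain x : (forall u, 0 <= x u) ->
  (forall i, \sum_(a : A i) x (elt a) = 1) -> pme_domain x.
Proof.
move=> x0 x1; split=> [[i a]|i]; last by rewrite x1.
(* The upper bound 1 is the mass of the block, in which [x] at this element is one of the
   nonnegative summands. *)
by rewrite x0 -(x1 i) (bigD1 a)//= lerDl sumr_ge0.
Qed.

End ActionSets.

(** * Integration over an event whose joint law with the state has a density *)

Section KernelDensity.
Import HBNNSimple numFieldNormedType.Exports.
Local Open Scope ereal_scope.
Local Open Scope classical_set_scope.
Context {d d'} {T : measurableType d} {S : measurableType d'} {R : realType}.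
Context {P : {measure set T -> \bar R}} {mu : {measure set S -> \bar R}}.
Context {st : T -> S} {D : set T} {k : S -> R}.
Hypotheses (mst : measurable_fun [set: T] st) (mD : measurable D).
Hypotheses (mk : measurable_fun [set: S] k) (k0 : forall s, (0 <= k s)%R).
Hypothesis Pk : forall B, measurable B ->
  P (st @^-1` B `&` D) = \int[mu]_(s in B) (k s)%:E.

Lemma nnsfun_integral_density (h : {nnsfun S >-> R}) :
  \int[P]_(w in D) (h (st w))%:E = \int[mu]_s (h s * k s)%:E.
Proof.
have mst1 B : measurable B -> measurable (st @^-1` B).
  by move=> mB; rewrite -[X in measurable X]setTI; exact: mst.
have mh (y : R) : measurable (h @^-1` [set y]) by exact: measurable_sfunP.
(* Both sides split over the finitely many values [y] of [h], weighted by the indicators of the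
   level sets. *)
under eq_integral do rewrite fimfunE -fsumEFin//.
under [RHS]eq_integral do rewrite fimfunE mulr_fsuml -fsumEFin//.
rewrite ge0_integral_fsum//; last 2 first.
- move=> y; apply/measurable_EFinP/measurable_funM => //.
  exact/measurable_funTS/measurableT_comp.
- by move=> y w _; rewrite EFinM nnfun_muleindic_ge0.
rewrite ge0_integral_fsum//; last 2 first.
- move=> y; apply/measurable_EFinP/measurable_funM => //.
  exact: measurable_funM.
- by move=> y s _; rewrite lee_fin mulr_ge0// -lee_fin EFinM nnfun_muleindic_ge0.
apply: eq_fsbigr => y /[!inE] -[s0 _ hy].
have y0 : (0 <= y)%R by rewrite -hy.
under eq_integral do rewrite EFinM.
under [RHS]eq_integral do rewrite -mulrA EFinM.
rewrite ge0_integralZl_EFin//; last 1 first.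
  exact/measurable_EFinP/measurable_funTS/measurableT_comp.
rewrite ge0_integralZl_EFin//; last 2 first.
- by move=> s _; rewrite lee_fin mulr_ge0.
- exact/measurable_EFinP/measurable_funM.
(* The density hypothesis [Pk] is applied to the level set of [h] at [y]. *)
congr (_ * _); transitivity (P (st @^-1` (h @^-1` [set y]) `&` D)).
  by rewrite -integral_indic//; exact: mst1.
rewrite Pk// integral_mkcond epatch_indic; apply: eq_integral => s _.
by rewrite /= -EFinM mulrC.
Qed.

Lemma ge0_integral_density (f : S -> R) :
  measurable_fun [set: S] f -> (forall s, (0 <= f s)%R) ->
  \int[P]_(w in D) (f (st w))%:E = \int[mu]_s (f s * k s)%:E.
Proof.
move=> mf f0.
have mfE : measurable_fun [set: S] (fun s => (f s)%:E) by exact/measurable_EFinP.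
pose h := nnsfun_approx measurableT mfE.
have hf s : h n s @[n --> \oo] --> f s.
  have := @cvg_nnsfun_approx _ _ _ _ measurableT _ mfE (fun x _ => f0 x) s Logic.I.
  by move/fine_cvgP => [].
have hle s a c : (a <= c)%N -> (h a s <= h c s)%R.
  by move=> ac; exact/lefP/nd_nnsfun_approx.
transitivity (limn (fun n => \int[P]_(w in D) (h n (st w))%:E)).
  rewrite -monotone_convergence//.
  - apply: eq_integral => w _; apply/esym/cvg_lim => //.
    by apply: cvg_EFin; [exact: nearW|exact: hf].
  - move=> n; apply/measurable_EFinP/measurable_funTS.
    exact: measurableT_comp.
  - by move=> n w _; rewrite lee_fin.
  - by move=> w _ a c ac; rewrite lee_fin hle.
(* Each approximant moves to the state space; since [k] is nonnegative, [h n * k] still increases,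
   and monotone convergence applies a second time. *)
under eq_fun do rewrite nnsfun_integral_density.
rewrite -monotone_convergence//.
- apply: eq_integral => w _; apply/cvg_lim => //.
  by apply: cvg_EFin; [exact: nearW|apply: cvgMr_tmp; exact: hf].
- by move=> n; apply/measurable_EFinP/measurable_funM.
- by move=> n w _; rewrite lee_fin mulr_ge0.
- by move=> w _ a c ac; rewrite lee_fin ler_wpM2r// hle.
Qed.

End KernelDensity.

(** * From the conditional identity to the stage value *)

Section StageValue.
Context {R : realType} {N : finType} {A : N -> finType}.
Context {dO dS : measure_display} {Obs : N -> measurableType dO} {S : measurableType dS}.
Context {O : S -> forall i, Obs i} { pi : forall i, Obs i -> A i -> R}.
Hypothesis O_meas : forall i, measurable_fun [set: S]%classic (fun s => O s i).
Hypothesis pi_policy : is_policy pi.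

Lemma joint_policy_ge0 (o : forall i, Obs i) (b : profile A) : 0 <= joint_policy pi o b.
Proof. by case: pi_policy => pi0 _ _; apply: prodr_ge0 => i _; exact: pi0. Qed.

Lemma measurable_joint_policy (b : profile A) :
  measurable_fun [set: S]%classic (fun s => joint_policy pi (O s) b).
Proof.
case: pi_policy => _ _ mpi; apply: measurable_prod => i _.
exact: measurableT_comp (mpi i (b i)) (O_meas i).
Qed.

Lemma policy_expectation_pme (o : forall i, Obs i) (f : {set ground A} -> R) :
  policy_expectation pi o f = pme f (marginals pi o).
Proof. by case: pi_policy => _ pi1 _; rewrite pme_profile_sum// => i; exact: pi1 i (o i). Qed.

Local Open Scope ereal_scope.

(** Nonnegativity of [F] lets finite sums and integrals be exchanged without integrability, so the
    identity also covers an infinite value. *)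
Lemma stage_value_policy_expectation (F : S -> {set ground A} -> R)
    (F_ge0 : forall s X, (0 <= F s X)%R)
    (F_meas : forall X, measurable_fun [set: S]%classic (fun s => F s X))
    (dT : measure_display) (T : measurableType dT) (P : probability T R)
    (st : {mfun T >-> S}) (act : T -> profile A) :
  plays_policy P pi O st act ->
  stage_value P F st act =
  'E_(distribution P st)[fun s => policy_expectation pi (O s) (F s)].
Proof.
move=> [mact Pact]; rewrite /stage_value unlock.
pose D b : set T := (act @^-1` [set b])%classic.
(* The events [D b] partition the sample space: at [w] only the term [b = act w] survives, which
   freezes the random action set in each summand. *)
transitivity (\int[P]_w \sum_(b : profile A)
    (F (st w) (action_set b) * \1_(D b) w)%:E).
  apply: eq_integral => w _; rewrite (bigD1 (act w))//= big1 => [|b ba].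
    by rewrite adde0 indicE mem_set// mulr1.
  by rewrite indicE memNset ?mulr0// => actb; case/eqP: ba.
have mst : measurable_fun [set: T]%classic st by exact: measurable_funP.
rewrite ge0_integral_sum//; last 2 first.
- move=> b; apply/measurable_EFinP/measurable_funM => //.
    exact: measurableT_comp (F_meas (action_set b)) mst.
  exact/measurable_indic/mact.
- by move=> b w _; rewrite lee_fin mulr_ge0.
under [RHS]eq_integral do rewrite -sumEFin.
rewrite [RHS]ge0_integral_sum//; last 2 first.
- move=> b; apply/measurable_EFinP/measurable_funM => //.
  exact: measurable_joint_policy.
- by move=> b s _; rewrite lee_fin mulr_ge0// joint_policy_ge0.
apply: eq_bigr => b _; under [RHS]eq_integral do rewrite mulrC.
(* On [D b] the integrand depends on [w] only through the state, and [Pact b] provides the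
   density. *)
rewrite -(ge0_integral_density mst (mact b) (measurable_joint_policy b) _ (Pact b))//.
  rewrite [RHS]integral_mkcond epatch_indic.
  by apply: eq_integral => w _; rewrite /= -EFinM.
by move=> s; exact: joint_policy_ge0.
Qed.

End StageValue.

Theorem lemma3p2 (R : realType) (N : finType) (A : N -> finType)
  (A_nonempty : forall i, (0 < #|A i|)%N)
  (dS dO : measure_display) (S : measurableType dS)
  (Obs : N -> measurableType dO) (O : S -> forall i, Obs i)
  (O_meas : forall i, measurable_fun [set: S]%classic (fun s => O s i))
  (F : S -> {set ground A} -> R)
  (F_ge0 : forall s X, 0 <= F s X)
  (F_normalized : forall s, normalized_fun (F s))
  (F_monotone : forall s, monotone_fun (F s))
  (F_submodular : forall s, submodular_fun (F s))
  (F_meas : forall X, measurable_fun [set: S]%classic (fun s => F s X))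
  (pi : forall i, Obs i -> A i -> R) (pi_policy : is_policy pi) :
  (forall s : S,
     pme_domain (marginals pi (O s)) /\
     policy_expectation pi (O s) (F s) = pme (F s) (marginals pi (O s))) /\
  (forall (dT : measure_display) (T : measurableType dT) (P : probability T R)
          (st : {mfun T >-> S}) (act : T -> profile A),
     plays_policy P pi O st act ->
     stage_value P F st act =
     ('E_(distribution P st)[fun s => pme (F s) (marginals pi (O s))])%E).
Proof.
split=> [s|dT T P st act play].
  split; last exact: policy_expectation_pme.
  case: pi_policy => pi0 pi1 _.
  by apply: mass1_pme_domain => [u|i]; [exact: pi0|exact: pi1 i (O s i)].
rewrite (stage_value_policy_expectation O_meas pi_policy _ F_ge0 F_meas _ _ _ _ _ play).
by congr expectation; apply/funext => s; exact: policy_expectation_pme.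
Qed.
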